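(* In the finite Markov decision setting with quantile preferences described in the context, the fundamental optimality properties hold for $(V,\mathbb T_Q)$, and VFI, OPI and HPI all converge.
   Context: Setting. $\mathsf X=\mathsf Y\times\mathsf Z$ (state space) and $\mathsf A$ (action space) are finite. $\Gamma$ is a nonempty-valued correspondence from $\mathsf X$ to $\mathsf A$, $\mathsf G=\{(x,a)\in\mathsf X\times\mathsf A:a\in\Gamma(x)\}$, $r:\mathsf G\to\mathbb R$ is a reward function, $P(z,z')$ is a stochastic matrix on $\mathsf Z$, and $H:\mathsf Y\times\mathsf A\times\mathsf Z\to\mathsf Y$. Constants $\beta\in(0,1)$ and $\tau\in(0,1)$ are given. Let $\underline r=\inf r$, $\bar r=\sup r$, and $V=[\underline r/(1-\beta),\bar r/(1-\beta)]\subset\mathbb R^{\mathsf G}$, the set of functions $q:\mathsf G\to\mathbb R$ lying pointwise between these constants, with the pointwise order. $\Sigma$ is the set of maps $\sigma:\mathsf X\to\mathsf A$ with $\sigma(x)\in\Gamma(x)$ for all $x$. For $\sigma\in\Sigma$, $q\in\mathbb R^{\mathsf G}$ and $(x,a)\in\mathsf G$ with $x=(y,z)$, $$(S_\sigma q)(x,a)=r(x,a)+\beta\min\Big\{k\in\mathbb R:\sum_{z'\in\mathsf Z}\mathbf 1\{q(x',\sigma(x'))\le k\}P(z,z')\ge\tau\Big\},\quad x'=(H(y,a,z'),z'),$$ and $\mathbb T_Q=\{S_\sigma:\sigma\in\Sigma\}$. Abstract dynamic programs. An abstract dynamic program (ADP) is a pair $(V,\mathbb T)$ where $V=(V,\preceq)$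 is a poset and $\mathbb T=\{T_\sigma:\sigma\in\Sigma\}$ is a nonempty family of order preserving self-maps on $V$ (here $T_\sigma=S_\sigma$ restricted to $V$). Given $v\in V$, $\sigma\in\Sigma$ is $v$-greedy if $T_\tau v\preceq T_\sigma v$ for all $\tau\in\Sigma$. The Bellman operator is $Tv:=\bigvee_\sigma T_\sigma v$ whenever the supremum exists; $v\in V$ solves the Bellman equation if $Tv$ exists and $Tv=v$. $(V,\mathbb T)$ is well-posed if each $T_\sigma$ has a unique fixed point $v_\sigma$ in $V$, and regular if a $v$-greedy policy exists for every $v\in V$. When $(V,\mathbb T)$ is well-posed, $V_\Sigma:=\{v_\sigma:\sigma\in\Sigma\}$; $\sigma$ is optimal if $v_\sigma$ is a greatest element of $V_\Sigma$; and the value function is $v^*:=\bigvee V_\Sigma$ whenever the supremum exists. Bellman's principle of optimality holds if $(V,\mathbb T)$ is well-posed and $\{\sigma\in\Sigma:\sigma\text{ is optimal}\}=\{\sigma\in\Sigma:\sigma\text{ is }v^*\text{-greedy}\}$ (both sets understood as empty if $v^*$ does not exist). The fundamental optimality properties hold if $(V,\mathbb T)$ is a well-posed and regular ADP and: (B1) at least one optimal policy exists; (B2) $v^*$ is the unique solution to the Bellman equation in $V$; (B3) Bellman's principle of optimality holds. Algorithms. Write $v_n\uparrow v$ if $(v_n)$ is increasing with supremum $v$. Fix, for each $v\in V$, a choice of $v$-greedy policy $\sigma$. Set $\mathcal Hv:=v_\sigma$ (Howard policy operator) and, for $m\in\mathbb N$, $m\ge1$, $W_mv:=T_\sigma^m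 v$, where $\sigma$ is the chosen $v$-greedy policy. Let $V_U=\{v\in V:v\preceq Tv\}$. VFI converges if $T^nv\uparrow v^*$ for all $v\in V_U$; OPI converges if $W_m^nv\uparrow v^*$ for all $v\in V_U$ (for each $m$); HPI converges if $\mathcal H^nv\uparrow v^*$ for all $v\in V_U$. *)

(* Defs.v *)
From HB Require Import structures.
From mathcomp Require Import all_boot all_order all_algebra.
From mathcomp Require Import all_classical all_reals.

Set Implicit Arguments.
Unset Strict Implicit.
Unset Printing Implicit Defensive.

Import Order.TTheory GRing.Theory Num.Theory.
Local Open Scope classical_set_scope.
Local Open Scope ring_scope.

(* Abstract dynamic programs.  The poset of the program is a subset [V] of an
   ambient poset [E], with the induced order; the policy operators are given as
   maps of [E], and [is_adp] requires that they map [V] into itself.  Suprema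
   are always least upper bounds inside [V].  Objects that need not exist, the
   value of the Bellman operator at v, v_sigma and v*, are represented by the
   predicate "w is this object", so no default value is ever used. *)
Section AbstractDynamicProgram.
Context {d : Order.disp_t} {E : porderType d} {Sigma : Type}.
Variables (V : set E) (T : Sigma -> E -> E).

Definition is_adp : Prop :=
  [/\ inhabited Sigma,
      forall s v, V v -> V (T s v) &
      forall s v w, V v -> V w -> (v <= w)%O -> (T s v <= T s w)%O].

Definition is_sup (A : set E) (s : E) : Prop :=
  [/\ V s, ubound A s & forall u, V u -> ubound A u -> (s <= u)%O].

Definition is_greatest (A : set E) (s : E) : Prop := A s /\ ubound A s.

Definition greedy (v : E) (s : Sigma) : Prop :=
  forall s', (T s' v <= T s v)%O.

(* "the Bellman operator is defined at v, with value w" *)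
Definition bellman (v w : E) : Prop := is_sup [set T s v | s in setT] w.

Definition solves_bellman (v : E) : Prop := V v /\ bellman v v.

(* "v is v_s": the one and only fixed point of [T s] in [V] *)
Definition policy_value (s : Sigma) (v : E) : Prop :=
  unique (fun w => V w /\ T s w = w) v.

Definition well_posed : Prop := forall s, exists v, policy_value s v.

Definition regular : Prop := forall v, V v -> exists s, greedy v s.

Definition policy_values : set E := [set v | exists s, policy_value s v].

Definition optimal (s : Sigma) : Prop :=
  exists2 v, policy_value s v & is_greatest policy_values v.

Definition value_function (v : E) : Prop := is_sup policy_values v.

(* When v* does not exist, both sets are empty: a greatest element of
   [policy_values] is in particular its supremum. *)
Definition principle_of_optimality : Prop :=
  well_posed /\
  [set s | optimal s] = [set s | exists2 v, value_function v & greedy v s].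

Definition fundamental_optimality : Prop :=
  [/\ is_adp, well_posed & regular] /\
  [/\ exists s, optimal s,
      exists2 v, value_function v & unique solves_bellman v &
      principle_of_optimality].

Definition increases_to (u : nat -> E) (v : E) : Prop :=
  {homo u : m n / (m <= n)%N >-> (m <= n)%O} /\ is_sup (range u) v.

Definition V_U : set E :=
  [set v | V v /\ exists2 w, bellman v w & (v <= w)%O].

Definition greedy_choice (g : E -> Sigma) : Prop :=
  forall v, V v -> greedy v (g v).

Definition VFI_converges : Prop :=
  exists2 vstar, value_function vstar &
  forall v, V_U v -> exists u : nat -> E,
    [/\ u 0%N = v, forall n, bellman (u n) (u n.+1) & increases_to u vstar].

Definition OPI_step (g : E -> Sigma) (m : nat) (v : E) : E :=
  iter m (T (g v)) v.

Definition OPI_converges (g : E -> Sigma) : Prop :=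
  exists2 vstar, value_function vstar &
  forall m, (0 < m)%N -> forall v, V_U v ->
    increases_to (fun n => iter n (OPI_step g m) v) vstar.

Definition HPI_converges (g : E -> Sigma) : Prop :=
  exists2 vstar, value_function vstar &
  forall v, V_U v -> exists u : nat -> E,
    [/\ u 0%N = v, forall n, policy_value (g (u n)) (u n.+1) &
        increases_to u vstar].

End AbstractDynamicProgram.

Definition stochastic {R : realType} {Z : finType} (P : Z -> Z -> R) : Prop :=
  (forall z z', 0 <= P z z') /\ (forall z, \sum_z' P z z' = 1).

(* The minimum of a set of reals; the default 0 is taken only when the minimum
   is not attained. *)
Definition min_set {R : realType} (A : set R) : R := xget 0 (A `&` lbound A).

Section QuantileDecisionProcess.
Context {R : realType} {Y Z A : finType}.
Variable Gamma : Y * Z -> {set A}.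

Definition feasible : Type := {xa : (Y * Z) * A | xa.2 \in Gamma xa.1}.

Definition policy : Type := {s : Y * Z -> A | forall x, s x \in Gamma x}.

Definition follow (s : policy) (x : Y * Z) : feasible :=
  exist (fun xa => xa.2 \in Gamma xa.1) (x, sval s x) (svalP s x).

Variables (r : feasible -> R) (P : Z -> Z -> R) (H : Y -> A -> Z -> Y).
Variables (beta tau : R).

(* S_sigma; for 0 < tau < 1 and P stochastic the minimum is attained. *)
Definition quantile_op (s : policy) (q : feasible -> R) : feasible -> R :=
  fun g => let: ((y, z), a) := sval g in
    r g + beta * min_set [set k : R |
      tau <= \sum_z' (q (follow s (H y a z', z')) <= k)%R%:R * P z z'].

Definition value_space : set (feasible -> R) :=
  [set q | forall g,
    inf (range r) / (1 - beta) <= q g <= sup (range r) / (1 - beta)].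

End QuantileDecisionProcess.

(* Main.v *)
(* Quantiles are monotone and commute with the addition of constants, so each
   S_sigma satisfies: v <= w + c implies S_sigma v <= S_sigma w + beta c.  Since
   S_sigma q at (x, a) sees q only through q (x', sigma x'), a policy maximizing
   q (x', .) at every x' is q-greedy, and the Bellman operator inherits the
   discounting inequality.
   For a discounting self-map F of a box of functions, v <= F v and F w <= w
   give v <= w + beta^n (b - a) for all n, hence v <= w; with Tarski's theorem
   this yields a unique fixed point, and applied to the Bellman operator it
   makes its fixed point v* the greatest policy value. *)
Require Import Defs.
From HB Require Import structures.
From mathcomp Require Import all_boot all_order all_algebra.
From mathcomp Require Import all_classical all_reals.
From mathcomp Require Import ring lra.
Set Implicit Arguments.
Unset Strict Implicit.
Unset Printing Implicit Defensive.
Import Order.TTheory GRing.Theory Num.Theory.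
Local Open Scope classical_set_scope.
Local Open Scope ring_scope.

(** * Discounting self-maps of a box of functions *)

Lemma le_geometric_le0 (R : realType) (beta c x : R) :
  0 < beta < 1 -> (forall n, x <= beta ^+ n * c) -> x <= 0.
Proof.
move=> /andP[beta_gt0 beta_lt1] xle.
pose S := [set y : R | forall n, y <= beta ^+ n * c].
have Sx : S x by [].
have ubS : ubound S c by move=> y /(_ 0%N); rewrite expr0 mul1r.
have supP y : S y -> y <= sup S by apply: ub_le_sup; exists c.
(* [S] is stable under division by [beta], so its supremum scales down and cannot be positive; no
   limit is taken. *)
have : sup S <= beta * sup S.
  apply: ge_sup; first by exists x.
  move=> y Sy; rewrite -ler_pdivrMl //; apply: supP => n.
  by rewrite ler_pdivrMl // mulrA -exprS.
have := supP x Sx; nra.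
Qed.

Definition box {R : realType} {I : Type} (a b : R) : set (I -> R) :=
  [set v | forall i, a <= v i <= b].

Section Discounting.
Context {R : realType} {I : Type} {a b beta : R}.
Hypothesis beta01 : 0 < beta < 1.
Local Notation V := (@box R I a b).

(** Blackwell's conditions in one inequality: [c = 0] gives monotonicity, general [c] the
    contraction. *)
Definition discounting (F : (I -> R) -> I -> R) : Prop :=
  forall v w c, V v -> V w -> 0 <= c -> (forall i, v i <= w i + c) ->
  forall i, F v i <= F w i + beta * c.

Lemma box_dist v w i : V v -> V w -> v i <= w i + (b - a).
Proof. by move=> /(_ i) /andP[_ vb] /(_ i) /andP[wa _]; lra. Qed.

Lemma box_dist_ge0 v (i : I) : V v -> 0 <= b - a.
Proof. by move=> /(_ i) /andP[av vb]; lra. Qed.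

Lemma le_add_geometric {v w : I -> R} :
  (forall n i, v i <= w i + beta ^+ n * (b - a)) -> (v <= w)%O.
Proof.
move=> vw; apply/lefP => i; rewrite -subr_le0.
apply: (@le_geometric_le0 _ beta (b - a)) => // n.
by rewrite lerBlDl vw.
Qed.

Variable F : (I -> R) -> I -> R.
Hypotheses (F_V : forall v, V v -> V (F v)) (F_disc : discounting F).

Lemma discounting_mono v w : V v -> V w -> (v <= w)%O -> (F v <= F w)%O.
Proof.
move=> Vv Vw /lefP vw; apply/lefP => i.
have := F_disc Vv Vw (lexx 0) _ i; rewrite mulr0 addr0; apply => j.
by rewrite addr0.
Qed.

(** Induction through [w <= F w <= F (u n) + beta ^+ n.+1 * (b - a)]. Asking only
    [F (u n) <= u n.+1] covers both a constant sequence and the iterates of all three algorithms. *)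
Lemma discounting_seq (u : nat -> I -> R) w :
  (forall n, V (u n)) -> V w -> (w <= F w)%O ->
  (forall n, F (u n) <= u n.+1)%O ->
  forall n i, w i <= u n i + beta ^+ n * (b - a).
Proof.
move=> Vu Vw /lefP wFw Fu; elim => [|n IHn] i.
  by rewrite expr0 mul1r box_dist.
have c_ge0 : 0 <= beta ^+ n * (b - a).
  rewrite mulr_ge0 ?(box_dist_ge0 i Vw) // exprn_ge0 //.
  by case/andP: beta01 => /ltW.
have := F_disc Vw (Vu n) c_ge0 IHn i.
have /lefP/(_ i) := Fu n; have := wFw i.
rewrite exprS -mulrA; lra.
Qed.

Lemma discounting_le v w :
  V v -> V w -> (v <= F v)%O -> (F w <= w)%O -> (v <= w)%O.
Proof.
move=> Vv Vw vFv Fww; apply: le_add_geometric.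
exact: (@discounting_seq (fun=> w)).
Qed.

Lemma discounting_fixpoint_uniq v w :
  V v -> V w -> F v = v -> F w = w -> v = w.
Proof.
move=> Vv Vw Fv Fw; apply: le_anti; apply/andP.
by split; apply: discounting_le => //; rewrite ?Fv ?Fw.
Qed.

(* Tarski: the box is a complete lattice. *)
Lemma discounting_fixpoint : a <= b -> exists2 v, V v & F v = v.
Proof.
move=> leab.
pose S := [set q | V q /\ (q <= F q)%O].
pose v i := sup [set q i | q in S].
have Sa : S (fun=> a).
  have Va : V (fun=> a) by move=> i; rewrite lexx.
  by split => //; apply/lefP => i; case/andP: (F_V Va i).
have Sv q : S q -> (q <= v)%O.
  move=> Sq; apply/lefP => i; apply: ub_le_sup; last by exists q.
  by exists b => _ [q' [Vq' _] <-]; case/andP: (Vq' i).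
have lev i x : (forall q, S q -> q i <= x) -> v i <= x.
  move=> Sx; apply: ge_sup; first by exists a, (fun=> a).
  by move=> _ [q Sq <-]; apply: Sx.
have Vv : V v.
  move=> i; have /lefP/(_ i) -> := Sv (fun=> a) Sa; apply: lev => q [Vq _].
  by case/andP: (Vq i).
have vFv : (v <= F v)%O.
  apply/lefP => i; apply: lev => q Sq.
  have [Vq /lefP qFq] := Sq; apply: le_trans (qFq i) _.
  by apply/lefP; apply: discounting_mono => //; apply: Sv.
exists v => //; apply: le_anti; rewrite vFv andbT; apply: Sv; split.
  exact: F_V.
by apply: discounting_mono => //; apply: F_V.
Qed.

End Discounting.

(** * Dynamic programs with discounting policy operators *)

Section DiscountedProgram.
Context {R : realType} {I Sigma : Type} {a b beta : R}.
Hypotheses (leab : a <= b) (beta01 : 0 < beta < 1).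
Local Notation V := (@box R I a b).
Variables (T : Sigma -> (I -> R) -> I -> R) (g : (I -> R) -> Sigma).
Hypotheses (T_V : forall s v, V v -> V (T s v))
  (T_disc : forall s, discounting (a := a) (b := b) (beta := beta) (T s))
  (g_greedy : greedy_choice V T g).

(** A greedy policy attains the supremum, so on [V] this total map is the Bellman operator. *)
Let B v := T (g v) v.

Let B_V v : V v -> V (B v).
Proof. exact: T_V. Qed.

Let T_le_B s v : V v -> (T s v <= B v)%O.
Proof. by move=> Vv; apply: g_greedy. Qed.

Let T_mono s v w : V v -> V w -> (v <= w)%O -> (T s v <= T s w)%O.
Proof. exact: discounting_mono. Qed.

(** The policy greedy at [v] is used at [w] too, where [B w] dominates it. *)
Let B_disc : discounting (a := a) (b := b) (beta := beta) B.
Proof.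
move=> v w c Vv Vw c_ge0 vw i.
apply: le_trans (T_disc (g v) Vv Vw c_ge0 vw i) _.
by rewrite lerD2r; have /lefP := T_le_B (g v) Vw; apply.
Qed.

Let policy_valueE s v : policy_value V T s v <-> V v /\ T s v = v.
Proof.
split=> [[]//|[Vv Tv]]; split=> // w [Vw Tw].
exact: (discounting_fixpoint_uniq beta01 (T_disc s)).
Qed.

Let wp : well_posed V T.
Proof.
move=> s; have [v Vv Tv] := discounting_fixpoint (T_V s) (T_disc s) leab.
by exists v; apply/policy_valueE.
Qed.

Let bellmanE v w : V v -> bellman V T v w <-> w = B v.
Proof.
move=> Vv; split => [[Vw ubw lew]|->].
  apply: le_anti; rewrite ubw ?andbT; last by exists (g v).
  by apply: lew; [exact: B_V | move=> _ [s _ <-]; exact: T_le_B].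
split; [exact: B_V | by move=> _ [s _ <-]; exact: T_le_B |].
by move=> u _; apply; exists (g v).
Qed.

Let V_UE v : V_U V T v <-> V v /\ (v <= B v)%O.
Proof.
split=> [[Vv [w /(bellmanE _ Vv) -> ?]]|[Vv vB]] //.
by split => //; exists (B v) => //; apply/bellmanE.
Qed.

Let vstar_spec v := [/\ V v, B v = v & value_function V T v].

(** The fixed point is the value of its own greedy policy, and any policy value satisfies
    [w = T s w <= B w], so comparison applies. *)
Let vstar_greatest v : V v -> B v = v -> is_greatest (policy_values V T) v.
Proof.
move=> Vv Bv; split.
  by exists (g v); apply/policy_valueE.
move=> w [s /policy_valueE[Vw Tw]].
apply: (discounting_le beta01 B_disc) => //; last by rewrite Bv.
by rewrite -{1}Tw T_le_B.
Qed.

Let greatest_sup v : V v -> is_greatest (policy_values V T) v ->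
  value_function V T v.
Proof. by move=> Vv [pv ubv]; split => // u _; apply. Qed.

Let sup_uniq (A : set (I -> R)) v w : is_sup V A v -> is_sup V A w -> v = w.
Proof.
by move=> [Vv uv lv] [Vw uw lw]; apply: le_anti; rewrite lv ?lw.
Qed.

Let vstar_ex : exists v, vstar_spec v.
Proof.
have [v Vv Bv] := discounting_fixpoint B_V B_disc leab.
by exists v; split => //; apply: greatest_sup => //; apply: vstar_greatest.
Qed.

Lemma discounted_fundamental_optimality : fundamental_optimality V T.
Proof.
have [v [Vv Bv vf]] := vstar_ex.
(* Being greedy at [v] also amounts to [T s v = v], because [B v = v]; this yields Bellman's
   principle. *)
have opt s : optimal V T s <-> T s v = v.
  split=> [[w /policy_valueE[Vw Tw] wgr]|Tv].
    by rewrite (sup_uniq vf (greatest_sup Vw wgr)).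
  by exists v; [apply/policy_valueE | apply: vstar_greatest].
split; split => //.
- by split=> //; exists; exact: (g (fun=> 0)).
- by move=> w Vw; exists (g w); apply: g_greedy.
- by exists (g v); apply/opt.
- exists v => //; split; first by split => //; apply/bellmanE.
  move=> w [Vw /(bellmanE _ Vw) Bw].
  exact: (discounting_fixpoint_uniq beta01 B_disc).
- split=> //; apply/seteqP; split=> s /=.
    move=> /opt Tv; exists v => // s'.
    by rewrite Tv -[leRHS]Bv T_le_B.
  move=> [w /(sup_uniq vf) <- gs]; apply/opt.
  by apply: le_anti; rewrite -{2 3}Bv T_le_B //= gs.
Qed.

Let V_U_le_vstar v w : vstar_spec v -> V_U V T w -> (w <= v)%O.
Proof.
move=> [Vv Bv _] /V_UE[Vw wB].
by apply: (discounting_le beta01 B_disc) => //; rewrite Bv.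
Qed.

(* The common core of VFI, OPI and HPI: each step dominates a Bellman step, so
   the gap to v* shrinks at least by the factor beta. *)
Let increases_to_vstar v (u : nat -> I -> R) : vstar_spec v ->
  (forall n, V_U V T (u n)) -> (forall n, B (u n) <= u n.+1)%O ->
  increases_to V u v.
Proof.
move=> vs Uu Bu; have [Vv Bv _] := vs.
have Vu n : V (u n) by case: (Uu n).
have vu := discounting_seq beta01 B_disc Vu Vv _ Bu.
split.
  apply: homo_leq => [x|x y z|n]; [exact: lexx|exact: le_trans|].
  by have /V_UE[_ /le_trans] := Uu n; apply.
split => //; first by move=> _ [n _ <-]; apply: V_U_le_vstar.
move=> w Vw ubw; apply: (@le_add_geometric _ _ a b beta beta01) => n i.
apply: le_trans (vu _ n i) _; first by rewrite Bv.
by rewrite lerD2r; have /lefP := ubw (u n) (imageT u n); apply.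
Qed.

Lemma discounted_VFI_converges : VFI_converges V T.
Proof.
have [v vs] := vstar_ex; exists v; first by case: vs.
move=> w Uw; pose u n := iter n B w.
have Uu n : V_U V T (u n).
  elim: n => [//|n /V_UE[Vu uB]]; apply/V_UE; split; first exact: B_V.
  by apply: (discounting_mono B_disc) uB => //; apply: B_V.
exists u; split => // [n|]; first by apply/bellmanE => //; case: (Uu n).
exact: increases_to_vstar.
Qed.

Lemma discounted_OPI_converges : OPI_converges V T g.
Proof.
have [v vs] := vstar_ex; exists v; first by case: vs.
move=> m m_gt0 w Uw.
have step u : V_U V T u ->
    V_U V T (OPI_step T g m u) /\ (B u <= OPI_step T g m u)%O.
  move=> /V_UE[Vu uB]; rewrite /OPI_step.
  have Vit k : V (iter k (T (g u)) u) by elim: k => //= k; apply: T_V.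
  (* Starts from [u <= B u = T (g u) u]. At [k = m] it keeps the result in [V_U], since one more
     application is below [B]. *)
  have it k : (iter k (T (g u)) u <= iter k.+1 (T (g u)) u)%O.
    by elim: k => //= k IHk; apply: T_mono => //; apply: T_V.
  split.
    apply/V_UE; split; [exact: Vit | apply: le_trans (it m) (T_le_B _ (Vit m))].
  (* [B u] is the first iterate, so for [m >= 1] it lies below the [m]-th. *)
  case: m m_gt0 => // k _.
  elim: k => // k IHk; exact: le_trans IHk (it k.+1).
pose u n := iter n (OPI_step T g m) w.
have Uu n : V_U V T (u n) by elim: n => // n /step[].
by apply: increases_to_vstar => // n; case: (step _ (Uu n)).
Qed.

Lemma discounted_HPI_converges : HPI_converges V T g.
Proof.
have [v vs] := vstar_ex; exists v; first by case: vs.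
move=> w Uw; have [h hP] := choice wp.
pose u n := iter n (h \o g) w.
have step x : V_U V T x -> V_U V T (h (g x)) /\ (B x <= h (g x))%O.
  move=> /V_UE[Vx xB]; have /policy_valueE[Vh Th] := hP (g x).
  (* [x <= B x = T (g x) x] makes [x] a subsolution for the operator whose fixed point is
     [h (g x)]. *)
  have xh : (x <= h (g x))%O.
    by apply: (discounting_le beta01 (T_disc (g x))) => //; rewrite Th.
  split; first by apply/V_UE; split=> //; rewrite -{1}Th T_le_B.
  by rewrite -[leRHS]Th; apply: T_mono.
have Uu n : V_U V T (u n) by elim: n => // n /step[].
exists u; split => //.
by apply: increases_to_vstar => // n; case: (step _ (Uu n)).
Qed.

End DiscountedProgram.

(** * Quantiles on a finite probability space *)

Section Quantile.
Context {R : realType} {Z : finType} {p : Z -> R} {tau : R}.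
Hypotheses (p_ge0 : forall z, 0 <= p z) (p_sum1 : \sum_z p z = 1).
Hypothesis tau01 : 0 < tau < 1.

Definition quantile_set (f : Z -> R) : set R :=
  [set k : R | tau <= \sum_z (f z <= k)%R%:R * p z].

(** Otherwise the sum is 0, which is below [tau]. *)
Lemma quantile_set_value f k : quantile_set f k -> exists z, f z <= k.
Proof.
rewrite /quantile_set /= => Sk; apply: contrapT => nz.
move: Sk; rewrite big1; first by case/andP: tau01; lra.
move=> z _; case: (boolP (f z <= k)) => [fk|_]; last by rewrite mul0r.
by case: nz; exists z.
Qed.

Lemma quantile_set_le f h k l :
  (forall z, f z <= k -> h z <= l) -> quantile_set f k -> quantile_set h l.
Proof.
rewrite /quantile_set => fh /= /le_trans; apply; apply: ler_sum => z _.
apply: ler_wpM2r => //; case: (boolP (f z <= k)) => [/fh ->|_] //.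
Qed.

Lemma quantile_set_ub f b : (forall z, f z <= b) -> quantile_set f b.
Proof.
move=> fb; rewrite /quantile_set /=.
rewrite (eq_bigr p) ?p_sum1 => [|z _]; last by rewrite fb mul1r.
by case/andP: tau01 => _ /ltW.
Qed.

(* The distribution function only jumps at values of f, so the minimum is one
   of those values. *)
Lemma quantileP f : let k := min_set (quantile_set f) in
  quantile_set f k /\ lbound (quantile_set f) k.
Proof.
(* Existence of a minimum rules out the default value of [min_set]. *)
apply: (@xgetPex _ 0 (quantile_set f `&` lbound (quantile_set f))).
have value_below k : quantile_set f k ->
    exists z, quantile_set f (f z) /\ f z <= k.
  move=> Sk; have [z0 fz0] := quantile_set_value Sk.
  case: (@arg_maxP _ _ Z z0 (fun z => f z <= k) f fz0) => z fz zmax.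
  by exists z; split => //; apply: quantile_set_le Sk => z' /zmax.
(* An upper bound of [f], so that some value of [f] is in the set and a least such value exists. *)
have Sub : quantile_set f (\sum_z `|f z|).
  apply: quantile_set_ub => z; rewrite (bigD1 z) //=.
  by rewrite (le_trans (ler_norm _)) // lerDl sumr_ge0.
have [z0 [Sz0 _]] := value_below _ Sub.
case: (@arg_minP _ _ Z z0 (fun z => `[< quantile_set f (f z) >]) f).
  exact/asboolP.
move=> z /asboolP Sz zmin; exists (f z); split => // k /value_below.
by move=> [z' [/asboolP /zmin zz' /(le_trans zz')]].
Qed.

(** With [m] the quantile of [h], the event [h <= m] is contained in [f <= m + c], so [m + c] is a
    candidate for [f]. *)
Lemma quantile_le f h c : (forall z, f z <= h z + c) ->
  min_set (quantile_set f) <= min_set (quantile_set h) + c.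
Proof.
move=> fh; have [Sh _] := quantileP h; have [_ lb] := quantileP f.
apply: lb; apply: quantile_set_le Sh => z hz.
by rewrite (le_trans (fh z)) // lerD2r.
Qed.

Lemma quantile_itv f a b : (forall z, a <= f z <= b) ->
  a <= min_set (quantile_set f) <= b.
Proof.
move=> fab; have [Sf lb] := quantileP f.
rewrite lb ?andbT; last first.
  by apply: quantile_set_ub => z; case/andP: (fab z).
have [z] := quantile_set_value Sf; apply: le_trans.
by case/andP: (fab z).
Qed.

End Quantile.

Lemma range_inf_sup (R : realType) (I : finType) (r : I -> R) i :
  inf (range r) <= r i <= sup (range r).
Proof.
have rle j : `|r j| <= \sum_k `|r k|.
  by rewrite (bigD1 j) //= lerDl sumr_ge0.
apply/andP; split; [apply: ge_inf | apply: ub_le_sup]; try by exists i.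
- exists (- \sum_k `|r k|) => _ [j _ <-]; have := rle j.
  by rewrite ler_norml => /andP[].
- exists (\sum_k `|r k|) => _ [j _ <-]; have := rle j.
  by rewrite ler_norml => /andP[].
Qed.

(** * The quantile decision process *)

Section QuantileProgram.
Context {R : realType} {Y Z A : finType} {Gamma : Y * Z -> {set A}}.
Variables (r : feasible Gamma -> R) (P : Z -> Z -> R) (H : Y -> A -> Z -> Y).
Variables (beta tau : R).
Hypotheses (P_stochastic : stochastic P) (beta01 : 0 < beta < 1)
  (tau01 : 0 < tau < 1).
Local Notation T := (quantile_op r P H beta tau).

(** Two policies are allowed so that [s = s'] gives discounting, while [v = w] with [c = 0] compares
    policies for greediness. *)
Lemma quantile_op_le s s' (v w : feasible Gamma -> R) c :
  (forall x, v (follow s x) <= w (follow s' x) + c) ->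
  forall i, T s v i <= T s' w i + beta * c.
Proof.
move=> vw [[[y z] a] ?]; rewrite /quantile_op /=.
rewrite -addrA lerD2l -mulrDr ler_pM2l; last by case/andP: beta01.
case: P_stochastic => P_ge0 P_sum1.
exact: (quantile_le (P_ge0 z) (P_sum1 z) tau01).
Qed.

Lemma feasible_itv g : inf (range r) <= r g <= sup (range r).
Proof.
exact: (@range_inf_sup R {xa : (Y * Z) * A | xa.2 \in Gamma xa.1} r g).
Qed.

Lemma quantile_op_value_space s v :
  value_space r beta v -> value_space r beta (T s v).
Proof.
move=> Vv g; have := feasible_itv g.
have beta_neq1 : 1 - beta != 0 by case/andP: beta01; lra.
case: g => [[[y z] a] h]; rewrite /quantile_op /=.
case: P_stochastic => P_ge0 P_sum1.
have := quantile_itv (P_ge0 z) (P_sum1 z) tau01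
  (fun z' => Vv (follow s (H y a z', z'))).
rewrite /quantile_set.
set k := min_set _; set l := _ / _; set u := _ / _.
(* The endpoints of the box are the fixed points of [t |-> inf r + beta t] and
   [t |-> sup r + beta t]. *)
have -> : inf (range r) = l - beta * l by rewrite /l; field.
have -> : sup (range r) = u - beta * u by rewrite /u; field.
case/andP: beta01 => ? ? /andP[? ?] /andP[? ?]; apply/andP; split; nra.
Qed.

Lemma value_space_bounds :
  inf (range r) / (1 - beta) <= sup (range r) / (1 - beta).
Proof.
rewrite ler_pM2r ?invr_gt0 ?subr_gt0; last by case/andP: beta01.
(* The state space may be empty; then [inf] and [sup] of the empty range are both 0. *)
have [[i _]|nr] := pselect (exists i : feasible Gamma, True).
  by case/andP: (feasible_itv i) => /le_trans; apply.
suff -> : range r = set0 by rewrite inf0 sup0.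
by apply/seteqP; split => // x [i _ _]; case: nr; exists i.
Qed.

Lemma follow_eq (s : policy Gamma) x (i : feasible Gamma) :
  (sval i).1 = x -> (sval i).2 = sval s x -> follow s x = i.
Proof.
by case: i => -[x' a] ha /= ex ea; apply: eq_exist; rewrite ex ea.
Qed.

Lemma quantile_greedy_ex (Gamma_neq0 : forall x, Gamma x != finset.set0) v :
  exists s, greedy T v s.
Proof.
have best x : {i : feasible Gamma | (sval i).1 = x /\
    forall j, (sval j).1 = x -> v j <= v i}.
  apply: cid; have /finset.set0Pn[a0 a0x] := Gamma_neq0 x.
  pose i0 : {xa : (Y * Z) * A | xa.2 \in Gamma xa.1} := exist _ (x, a0) a0x.
  case: (@arg_maxP _ _ _ i0 (fun i => (sval i).1 == x) v (eqxx x)).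
  move=> i /eqP ix imax; exists i; split => // j /eqP; exact: imax.
have s_feasible x : (sval (sval (best x))).2 \in Gamma x.
  by case: (best x) => i /= [<- _]; apply: (svalP i).
exists (exist _ (fun x => (sval (sval (best x))).2) s_feasible) => s'.
apply/lefP => i; rewrite -[leRHS]addr0 -[X in _ + X](mulr0 beta).
apply: quantile_op_le => x; rewrite addr0.
set j := follow (exist _ _ _) x.
have -> : j = sval (best x).
  by apply: follow_eq => //; case: (best x) => i' [].
by case: (best x) => i' /= [_]; apply.
Qed.

End QuantileProgram.

Theorem proposition6p8 (R : realType) (Y Z A : finType)
    (Gamma : Y * Z -> {set A})
    (Gamma_neq0 : forall x, Gamma x != finset.set0)
    (r : feasible Gamma -> R)
    (P : Z -> Z -> R) (P_stochastic : stochastic P)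
    (H : Y -> A -> Z -> Y)
    (beta tau : R) (beta01 : 0 < beta < 1) (tau01 : 0 < tau < 1) :
  let V := value_space r beta in
  let T := quantile_op r P H beta tau in
  fundamental_optimality V T /\
  VFI_converges V T /\
  forall g : (feasible Gamma -> R) -> policy Gamma, greedy_choice V T g ->
    OPI_converges V T g /\ HPI_converges V T g.
Proof.
move=> V T.
have leab := value_space_bounds r beta01.
have T_V := quantile_op_value_space (r := r) H P_stochastic beta01 tau01.
have T_disc s : discounting (a := inf (range r) / (1 - beta))
    (b := sup (range r) / (1 - beta)) (beta := beta) (T s).
  by move=> v w c _ _ _ vw; apply: quantile_op_le.
(* The optimality properties and VFI do not mention a greedy selection, so any one serves; OPI and
   HPI use the given [g]. *)
have [g0 g0P] := choice (quantile_greedy_ex r H P_stochastic beta01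
  tau01 Gamma_neq0).
have g0_greedy : greedy_choice V T g0 by move=> v _; apply: g0P.
split.
  exact: (discounted_fundamental_optimality leab beta01 T_V T_disc g0_greedy).
split.
  exact: (discounted_VFI_converges leab beta01 T_V T_disc g0_greedy).
move=> g g_greedy; split.
  exact: (discounted_OPI_converges leab beta01 T_V T_disc g_greedy).
exact: (discounted_HPI_converges leab beta01 T_V T_disc g_greedy).
Qed.
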